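(* Let $I$ be a locally finite directed poset and let $A$ be a connected, positively indexed, tails-finitely generated $I$-indexed algebra. Then $\mathsf{Tors}\,A$ is a localising subcategory of finite type in $\mathsf{Gr}\,A$.
   Context: A poset $I$ is locally finite if all intervals $[i,j]$ are finite, and directed if any two elements have a common upper bound. An $I$-indexed algebra is a ring $A=\bigoplus_{i,j\in I}A_{ij}$ with multiplication $A_{id}\times A_{dj}\to A_{ij}$ and local units $e_i\in A_{ii}$ (equivalently a preadditive category with objects $\mathcal{A}_i$ indexed by $I$ and $A_{ij}=\mathrm{Hom}(\mathcal{A}_j,\mathcal{A}_i)$). It is connected if each $A_{ii}$ is a division ring and positively indexed if $A_{ij}\ne0$ only when $i\le j$. $\mathsf{Gr}\,A$ is the (Grothendieck) category of graded right modules $M=\bigoplus_iM_i$ with action maps $M_i\times A_{ij}\to M_j$. Put $P_i=e_iA$ and $M_{>d}=\bigoplus_{j>d}M_j$. A module is finitely generated if it is a quotient of a finite direct sum of modules $P_i$; $A$ is tails-finitely generated if $(P_i)_{>d}$ is finitely generated for all $i,d\in I$. $M$ is upper-bounded if $M_{>d}=0$ for some $d\in I$, and torsion if it is a directed colimit of upper-bounded modules; $\mathsf{Tors}\,A$ is the full subcategory of torsion modules, and $\tau(M)$ denotes the largest torsion submodule of $M$ (the torsion functor $\tau:\mathsf{Gr}\,A\to\mathsf{Tors}\,A$). A localising subcategory of a Grothendieck category is a Serre subcategory whose quotient functor has a right adjoint; it is of finite type if the associated torsion functor (the right adjoint of the inclusion) commutes with directed colimits. *)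

(* Defs.v *)
From HB Require Import structures.
From mathcomp Require Import all_boot all_order all_algebra.
From mathcomp Require Import boolp classical_sets cardinality.

Set Implicit Arguments.
Unset Strict Implicit.
Unset Printing Implicit Defensive.

Import Order.TTheory GRing.Theory.

#[local] Obligation Tactic := idtac.

(** * Categories *)

Record category := Category {
  ob :> Type;
  mor : ob -> ob -> Type;
  idm : forall X, mor X X;
  mcomp : forall X Y Z, mor Y Z -> mor X Y -> mor X Z;
  comp_idl : forall X Y (f : mor X Y), mcomp (idm Y) f = f;
  comp_idr : forall X Y (f : mor X Y), mcomp f (idm X) = f;
  comp_assoc : forall X Y Z T (h : mor Z T) (g : mor Y Z) (f : mor X Y),
    mcomp h (mcomp g f) = mcomp (mcomp h g) f }.

Arguments mor {c}.
Arguments idm {c}.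
Arguments mcomp {c X Y Z}.

Record functor (C D : category) := Functor {
  fob :> C -> D;
  fmap : forall X Y, mor X Y -> mor (fob X) (fob Y);
  fmap_id : forall X, fmap (idm X) = idm (fob X);
  fmap_comp : forall X Y Z (g : mor Y Z) (f : mor X Y),
    fmap (mcomp g f) = mcomp (fmap g) (fmap f) }.

Arguments fmap {C D} _ {X Y}.

Program Definition functor_comp (C D E : category)
    (G : functor D E) (F : functor C D) : functor C E :=
  {| fob := fun X => G (F X); fmap := fun X Y f => fmap G (fmap F f) |}.
Next Obligation. by move=> C D E G F X; rewrite /= !fmap_id. Qed.
Next Obligation. by move=> C D E G F X Y Z g f; rewrite /= !fmap_comp. Qed.

Record nat_trans (C D : category) (F G : functor C D) := NatTrans {
  nt :> forall X, mor (F X) (G X);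
  nt_natural : forall X Y (f : mor X Y),
    mcomp (nt Y) (fmap F f) = mcomp (fmap G f) (nt X) }.

Definition is_iso (C : category) (X Y : C) (f : mor X Y) : Prop :=
  exists g : mor Y X, mcomp g f = idm X /\ mcomp f g = idm Y.

Definition nat_isomorphic (C D : category) (F G : functor C D) : Prop :=
  exists eta : nat_trans F G, forall X, is_iso (eta X).

Definition adjoint (C D : category) (F : functor C D) (G : functor D C) : Prop :=
  exists phi : forall (X : C) (Y : D), mor (F X) Y -> mor X (G Y),
    [/\ forall X Y, bijective (phi X Y),
        forall X X' Y (g : mor (F X) Y) (f : mor X' X),
          phi X' Y (mcomp g (fmap F f)) = mcomp (phi X Y g) f
      & forall X Y Y' (h : mor Y Y') (g : mor (F X) Y),
          phi X Y' (mcomp h g) = mcomp (fmap G h) (phi X Y g)].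

Definition full_subcat (C : category) (S : C -> Prop) : category :=
  {| ob := {X : C | S X};
     mor := fun X Y => mor (sval X) (sval Y);
     idm := fun X => idm (sval X);
     mcomp := fun _ _ _ g f => mcomp g f;
     comp_idl := fun _ _ f => comp_idl f;
     comp_idr := fun _ _ f => comp_idr f;
     comp_assoc := fun _ _ _ _ h g f => comp_assoc h g f |}.

Definition inclusion (C : category) (S : C -> Prop) :
    functor (full_subcat S) C :=
  @Functor (full_subcat S) C (fun X => sval X) (fun _ _ f => f)
    (fun _ => erefl) (fun _ _ _ _ _ => erefl).

Definition inverts (C D : category) (W : forall X Y : C, mor X Y -> Prop)
    (F : functor C D) : Prop :=
  forall (X Y : C) (f : mor X Y), W X Y f -> is_iso (fmap F f).

(* The universal property of [C -> C[W^-1]]: for every [E], precomposition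
   with [Q] is an equivalence from the functors [D -> E] to the functors
   [C -> E] inverting [W]; this determines [D] up to equivalence. *)
Record is_localization (C D : category) (W : forall X Y : C, mor X Y -> Prop)
    (Q : functor C D) : Prop := IsLocalization {
  loc_inverts : inverts W Q;
  loc_factor : forall (E : category) (F : functor C E), inverts W F ->
    exists G : functor D E, nat_isomorphic (functor_comp G Q) F;
  loc_ff : forall (E : category) (G G' : functor D E)
      (eta : nat_trans (functor_comp G Q) (functor_comp G' Q)),
    exists! theta : nat_trans G G', forall X : C, theta (Q X) = eta X }.

(** * Posets and directed colimits *)

Definition directed {d} (I : porderType d) : Prop :=
  forall i j : I, exists k : I, (i <= k)%O /\ (j <= k)%O.

Definition locally_finite {d} (I : porderType d) : Prop :=
  forall i j : I, finite_set [set k : I | (i <= k <= j)%O]%classic.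

Program Definition poset_cat {d} (J : porderType d) : category :=
  {| ob := J; mor := fun i j => is_true (i <= j)%O;
     idm := fun i => lexx i;
     mcomp := fun i j k jk ij => le_trans ij jk |}.
Next Obligation. by move=> *; apply: bool_irrelevance. Qed.
Next Obligation. by move=> *; apply: bool_irrelevance. Qed.
Next Obligation. by move=> *; apply: bool_irrelevance. Qed.

Definition is_cocone (K C : category) (D : functor K C) (X : C)
    (leg : forall k, mor (D k) X) : Prop :=
  forall k l (f : mor k l), mcomp (leg l) (fmap D f) = leg k.

Definition is_colimit (K C : category) (D : functor K C) (X : C)
    (leg : forall k, mor (D k) X) : Prop :=
  is_cocone leg /\
  forall (Y : C) (leg' : forall k, mor (D k) Y), is_cocone leg' ->
    exists! h : mor X Y, forall k, mcomp h (leg k) = leg' k.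

Definition preserves_directed_colimits (C D : category) (F : functor C D) :
    Prop :=
  forall (d : Order.disp_t) (J : porderType d), directed J ->
  forall (Diag : functor (poset_cat J) C) (X : C)
         (leg : forall j, mor (Diag j) X),
    is_colimit leg ->
    @is_colimit _ _ (functor_comp F Diag) (F X) (fun j => fmap F (leg j)).

(** * Indexed algebras *)

Local Open Scope ring_scope.

(* The preadditive category with object set [I]; [A i j] is the component
   [A_ij], and no ring structure is put on the direct sum itself. *)
Record indexed_alg (I : Type) := IndexedAlg {
  icomp :> I -> I -> zmodType;
  imul : forall i d j, icomp i d -> icomp d j -> icomp i j;
  iunit : forall i, icomp i i;
  imulDl : forall i d j (a a' : icomp i d) (b : icomp d j),
    imul (a + a') b = imul a b + imul a' b;
  imulDr : forall i d j (a : icomp i d) (b b' : icomp d j),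
    imul a (b + b') = imul a b + imul a b';
  imulA : forall i d l j (a : icomp i d) (b : icomp d l) (c : icomp l j),
    imul a (imul b c) = imul (imul a b) c;
  imul1l : forall i j (a : icomp i j), imul (iunit i) a = a;
  imul1r : forall i j (a : icomp i j), imul a (iunit j) = a }.

Arguments imul {I _ i d j}.
Arguments iunit {I _} i.

Definition connected (I : Type) (A : indexed_alg I) : Prop :=
  forall i, iunit i != 0 :> A i i /\
    forall a : A i i, a != 0 ->
      exists b : A i i, imul a b = iunit i /\ imul b a = iunit i.

Definition positively_indexed {d} (I : porderType d) (A : indexed_alg I) : Prop :=
  forall i j, (exists a : A i j, a != 0) -> (i <= j)%O.

(** * Graded right modules *)

Record gr_mod (I : Type) (A : indexed_alg I) := GrMod {
  gcomp :> I -> zmodType;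
  gact : forall i j, gcomp i -> A i j -> gcomp j;
  gactDl : forall i j (x y : gcomp i) (a : A i j),
    gact (x + y) a = gact x a + gact y a;
  gactDr : forall i j (x : gcomp i) (a b : A i j),
    gact x (a + b) = gact x a + gact x b;
  gactA : forall i j k (x : gcomp i) (a : A i j) (b : A j k),
    gact x (imul a b) = gact (gact x a) b;
  gact1 : forall i (x : gcomp i), gact x (iunit i) = x }.

Arguments gact {I A _ i j}.

Record gr_hom (I : Type) (A : indexed_alg I) (M N : gr_mod A) := GrHom {
  gfun :> forall i, M i -> N i;
  gfunD : forall i (x y : M i), gfun (x + y) = gfun x + gfun y;
  gfunA : forall i j (x : M i) (a : A i j), gfun (gact x a) = gact (gfun x) a }.

Lemma gr_hom_ext (I : Type) (A : indexed_alg I) (M N : gr_mod A)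
    (f g : gr_hom M N) : (forall i x, f i x = g i x) -> f = g.
Proof.
case: f g => [f fD fA] [g gD gA] /= fg.
have {}fg : f = g.
  by apply: functional_extensionality_dep => i; apply: funext => x.
by subst g; congr GrHom; apply: Prop_irrelevance.
Qed.

Program Definition gr_id (I : Type) (A : indexed_alg I) (M : gr_mod A) :
  gr_hom M M := {| gfun := fun i x => x |}.
Next Obligation. by []. Qed.
Next Obligation. by []. Qed.

Program Definition gr_comp (I : Type) (A : indexed_alg I) (M N P : gr_mod A)
    (g : gr_hom N P) (f : gr_hom M N) : gr_hom M P :=
  {| gfun := fun i x => g i (f i x) |}.
Next Obligation. by move=> I A M N P g f i x y; rewrite /= !gfunD. Qed.
Next Obligation. by move=> I A M N P g f i j x a; rewrite /= !gfunA. Qed.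

Program Definition Gr (I : Type) (A : indexed_alg I) : category :=
  {| ob := gr_mod A; mor := @gr_hom I A; idm := @gr_id I A;
     mcomp := @gr_comp I A |}.
Next Obligation. by move=> *; apply: gr_hom_ext. Qed.
Next Obligation. by move=> *; apply: gr_hom_ext. Qed.
Next Obligation. by move=> *; apply: gr_hom_ext. Qed.

(* [e_i A], with component [A i j] in degree [j]. *)
Definition gr_proj (I : Type) (A : indexed_alg I) (i : I) : gr_mod A :=
  {| gcomp := A i;
     gact := fun j k x a => imul x a;
     gactDl := fun j k x y a => imulDl x y a;
     gactDr := fun j k x a b => imulDr x a b;
     gactA := fun j k l x a b => imulA x a b;
     gact1 := fun j x => imul1r x |}.

Section FiniteProduct.
Variables (n : nat) (V : 'I_n -> zmodType).

Definition dprod : Type := {dffun forall k : 'I_n, V k}.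

HB.instance Definition _ := Choice.on dprod.

Definition dprod0 : dprod := [ffun k => 0].
Definition dprodN (x : dprod) : dprod := [ffun k => - x k].
Definition dprodD (x y : dprod) : dprod := [ffun k => x k + y k].

Fact dprodDA : associative dprodD.
Proof. by move=> x y z; apply/ffunP => k; rewrite !ffunE addrA. Qed.
Fact dprodDC : commutative dprodD.
Proof. by move=> x y; apply/ffunP => k; rewrite !ffunE addrC. Qed.
Fact dprodD0 : left_id dprod0 dprodD.
Proof. by move=> x; apply/ffunP => k; rewrite !ffunE add0r. Qed.
Fact dprodDN : left_inverse dprod0 dprodN dprodD.
Proof. by move=> x; apply/ffunP => k; rewrite !ffunE addNr. Qed.

HB.instance Definition _ :=
  GRing.isZmodule.Build dprod dprodDA dprodDC dprodD0 dprodDN.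
End FiniteProduct.

Program Definition gr_dsum (I : Type) (A : indexed_alg I) (n : nat)
    (M : 'I_n -> gr_mod A) : gr_mod A :=
  {| gcomp := fun i => dprod (fun k => M k i);
     gact := fun i j (x : dprod _) a => [ffun k => gact (x k) a] |}.
Next Obligation.
by move=> I A n M i j x y a; apply/ffunP => k; rewrite !ffunE gactDl.
Qed.
Next Obligation.
by move=> I A n M i j x a b; apply/ffunP => k; rewrite !ffunE gactDr.
Qed.
Next Obligation.
by move=> I A n M i j l x a b; apply/ffunP => k; rewrite !ffunE gactA.
Qed.
Next Obligation.
by move=> I A n M i x; apply/ffunP => k; rewrite !ffunE gact1.
Qed.

Definition gr_inj (I : Type) (A : indexed_alg I) (M N : gr_mod A)
    (f : gr_hom M N) : Prop := forall i, injective (f i).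

Definition gr_surj (I : Type) (A : indexed_alg I) (M N : gr_mod A)
    (f : gr_hom M N) : Prop := forall i (y : N i), exists x : M i, f i x = y.

Definition gr_exact (I : Type) (A : indexed_alg I) (M N P : gr_mod A)
    (f : gr_hom M N) (g : gr_hom N P) : Prop :=
  forall i (y : N i), g i y = 0 <-> exists x : M i, f i x = y.

Definition finitely_generated (I : Type) (A : indexed_alg I) (M : gr_mod A) :
    Prop :=
  exists (n : nat) (s : 'I_n -> I)
    (f : gr_hom (gr_dsum (fun k => gr_proj A (s k))) M), gr_surj f.

(** * Tails *)

Section TailComponent.
Context {d : Order.disp_t} {I : porderType d} {A : indexed_alg I}.
Variables (M : gr_mod A) (i j : I).

Definition tail_pred : {pred M j} := fun x => (i < j)%O || (x == 0).

Fact tail_pred_zmod_closed : zmod_closed tail_pred.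
Proof.
split=> [|x y]; rewrite !unfold_in ?eqxx ?orbT //.
by case: (i < j)%O => //= /eqP-> /eqP->; rewrite subr0.
Qed.

HB.instance Definition _ :=
  GRing.isZmodClosed.Build (M j) tail_pred tail_pred_zmod_closed.

(* The degree [j] component of [M_{>i}]: all of [M_j] if [i < j], else [0]. *)
Definition tail_comp : Type := {x : M j | x \in tail_pred}.

HB.instance Definition _ := SubChoice.on tail_comp.
HB.instance Definition _ := [SubChoice_isSubZmodule of tail_comp by <:].
End TailComponent.

Arguments tail_pred {d I A} M i j _.

Section Tail.
Context {d : Order.disp_t} {I : porderType d} {A : indexed_alg I}.
Variables (Apos : positively_indexed A) (M : gr_mod A) (i : I).

Fact gact0l j k (a : A j k) : gact (0 : M j) a = 0.
Proof. by apply: (addrI (gact 0 a)); rewrite -gactDl !addr0. Qed.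

Fact gact0r j k (x : M j) : gact x (0 : A j k) = 0.
Proof. by apply: (addrI (gact x 0)); rewrite -gactDr !addr0. Qed.

Fact tail_act_subproof j k (x : tail_comp M i j) (a : A j k) :
  gact (val x) a \in tail_pred M i k.
Proof.
case: x => x /=; rewrite !unfold_in => /orP[ij|/eqP->]; last first.
  by rewrite gact0l eqxx orbT.
have [->|a0] := eqVneq a 0; first by rewrite gact0r eqxx orbT.
by rewrite (lt_le_trans ij) //; apply: Apos; exists a.
Qed.

Definition tail_act j k (x : tail_comp M i j) (a : A j k) : tail_comp M i k :=
  Sub (gact (val x) a) (tail_act_subproof x a).

Program Definition tail : gr_mod A :=
  {| gcomp := fun j => tail_comp M i j; gact := tail_act |}.
Next Obligation. by move=> *; apply: val_inj; rewrite /= gactDl. Qed.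
Next Obligation. by move=> *; apply: val_inj; rewrite /= gactDr. Qed.
Next Obligation. by move=> *; apply: val_inj; rewrite /= gactA. Qed.
Next Obligation. by move=> *; apply: val_inj; rewrite /= gact1. Qed.
End Tail.

Definition tails_finitely_generated {d} (I : porderType d) (A : indexed_alg I)
    (Apos : positively_indexed A) : Prop :=
  forall i j : I, finitely_generated (tail Apos (gr_proj A i) j).

(** * Torsion modules *)

Definition upper_bounded {d} (I : porderType d) (A : indexed_alg I)
    (M : gr_mod A) : Prop :=
  exists i : I, forall j : I, (i < j)%O -> forall x : M j, x = 0.

Definition torsion {d} (I : porderType d) (A : indexed_alg I)
    (M : Gr A) : Prop :=
  exists (d' : Order.disp_t) (J : porderType d')
    (Diag : functor (poset_cat J) (Gr A)) (leg : forall j, mor (Diag j) M),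
  [/\ directed J, is_colimit leg & forall j, upper_bounded (Diag j)].

(** * Localising subcategories *)

(* Subcategories are full, given by a predicate on objects; being Serre makes
   the predicate invariant under isomorphism. *)
Definition is_serre (I : Type) (A : indexed_alg I) (S : Gr A -> Prop) : Prop :=
  (exists M : Gr A, S M) /\
  forall (M' M M'' : gr_mod A) (f : gr_hom M' M) (g : gr_hom M M''),
    gr_inj f -> gr_exact f g -> gr_surj g -> (S M <-> S M' /\ S M'').

(* Morphisms whose kernel [K] and cokernel [L] lie in [S]. *)
Definition iso_mod (I : Type) (A : indexed_alg I) (S : Gr A -> Prop)
    (M N : Gr A) (f : mor M N) : Prop :=
  exists (K L : gr_mod A) (k : gr_hom K M) (c : gr_hom N L),
    [/\ S K, S L, gr_inj k /\ gr_exact k f & gr_exact f c /\ gr_surj c].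

(* [Q] is the quotient functor [Gr A -> Gr A / S], the quotient by a Serre
   subcategory being the localization at the morphisms of [iso_mod S]. *)
Definition is_quotient_functor (I : Type) (A : indexed_alg I)
    (S : Gr A -> Prop) (D : category) (Q : functor (Gr A) D) : Prop :=
  is_localization (iso_mod S) Q.

Definition localising (I : Type) (A : indexed_alg I) (S : Gr A -> Prop) : Prop :=
  is_serre S /\
  exists (D : category) (Q : functor (Gr A) D),
    is_quotient_functor S Q /\ exists R : functor D (Gr A), adjoint Q R.

Definition of_finite_type (I : Type) (A : indexed_alg I) (S : Gr A -> Prop) :
    Prop :=
  exists t : functor (Gr A) (full_subcat S),
    adjoint (inclusion S) t /\ preserves_directed_colimits t.

(* Main.v *)
From HB Require Import structures.
From mathcomp Require Import all_boot all_order all_algebra.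
From mathcomp Require Import ring_quotient boolp classical_sets filter.
Require Import Defs.

Set Implicit Arguments.
Unset Strict Implicit.
Unset Printing Implicit Defensive.

(** Everything rests on one criterion and one use of finite generation.

    A module is torsion iff each of its elements [x], in degree [i] say, is
    annihilated by a tail of [gr_proj A i]: there is [e] with [x a = 0] for all
    [a : A i j], [j > e] (lemma [torsionP]).  Indeed the elements killed beyond
    [e] form an upper-bounded submodule, and these submodules form a directed
    system indexed by [I] itself.  Write [tors M] for the submodule of these
    elements; it is the largest torsion submodule.

    Call a property of [j : I] eventual if it holds for all [j] greater than
    some [e].  Since tails are finitely generated, a property of the elements
    [a] of a tail that is compatible with sums and multiples, and holds
    eventually for each [a] separately, holds eventually for all [a] at once
    (lemmas [tail_uniform] and [tails_uniform]).  This exchange of quantifiers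
    gives:

    - closure of torsion modules under extensions, hence the Serre property:
      if [x a] is torsion for all late [a], then [x] is torsion;
    - finite type: if the image of [y] in a directed colimit is torsion, then
      each [y a], for [a] in a tail, dies at some stage; hence all of them die
      at a common stage, where [y] becomes torsion;
    - the existence of closed hulls.  The closed hull of a torsion-free [M]
      consists, in degree [i], of the germs at infinity of morphisms from
      [gr_proj A i] to [M].  It is realised inside the module of germs of
      families of additive maps [A i j -> M j], as the set of germs whose late
      multiples come from [M].

    The quotient category is then obtained as the full subcategory of the
    modules that see the morphisms with torsion kernel and cokernel as
    isomorphisms.  Closed hulls make it reflective, with units in the class of
    inverted morphisms, and any such reflection is a localization whose right
    adjoint is the inclusion (lemma [reflective_localization]). *)

#[local] Obligation Tactic := idtac.

Import Order.TTheory GRing.Theory.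
Local Open Scope ring_scope.
Local Open Scope quotient_scope.

(** * Graded modules *)

Section Action.
Context {I : Type} {A : indexed_alg I}.

Lemma gactBl (M : gr_mod A) i j (x y : M i) (a : A i j) :
  gact (x - y) a = gact x a - gact y a.
Proof. by apply: (addIr (gact y a)); rewrite -gactDl !subrK. Qed.

Lemma gact0 {M : gr_mod A} i j (a : A i j) : gact (0 : M i) a = 0.
Proof. by rewrite -[X in gact X _](subrr (0 : M i)) gactBl subrr. Qed.

Lemma imulBr i d j (a : A i d) (b b' : A d j) :
  imul a (b - b') = imul a b - imul a b'.
Proof. by apply: (addIr (imul a b')); rewrite -imulDr !subrK. Qed.

Lemma imul0 i d j (b : A d j) : imul (0 : A i d) b = 0.
Proof. exact: (gact0 (M := gr_proj A i) b). Qed.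

Lemma gfunB (M N : gr_mod A) (f : gr_hom M N) i (x y : M i) :
  f i (x - y) = f i x - f i y.
Proof. by apply: (addIr (f i y)); rewrite -gfunD !subrK. Qed.

HB.instance Definition _ (M N : gr_mod A) (f : gr_hom M N) i :=
  GRing.isZmodMorphism.Build (M i) (N i) (f i) (@gfunB M N f i).
End Action.

(** * Submodules and quotient modules *)

Record submod (I : Type) (A : indexed_alg I) (M : gr_mod A) := Submod {
  smem :> forall i, M i -> Prop;
  smem0 : forall i, smem (0 : M i);
  smemB : forall i (x y : M i), smem x -> smem y -> smem (x - y);
  smemA : forall i j (x : M i) (a : A i j), smem x -> smem (gact x a) }.

Section Submodule.
Context {I : Type} {A : indexed_alg I} {M : gr_mod A}.
Variable U : submod M.

Definition sub_pred i : {pred M i} := fun x => `[< U i x >].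
Arguments sub_pred : clear implicits.

Fact sub_pred_zmod_closed i : zmod_closed (sub_pred i).
Proof.
split=> [|x y]; rewrite !unfold_in; first exact/asboolP/smem0.
by move=> /asboolP Ux /asboolP Uy; apply/asboolP/smemB.
Qed.

HB.instance Definition _ i :=
  GRing.isZmodClosed.Build (M i) (sub_pred i) (@sub_pred_zmod_closed i).

Definition sub_comp i : Type := {x : M i | x \in sub_pred i}.

HB.instance Definition _ i := SubChoice.on (sub_comp i).
HB.instance Definition _ i := [SubChoice_isSubZmodule of sub_comp i by <:].

Fact sub_act_subproof i j (x : sub_comp i) (a : A i j) :
  gact (val x) a \in sub_pred j.
Proof.
by case: x => x /=; rewrite !unfold_in => /asboolP Ux; apply/asboolP/smemA.
Qed.

Definition sub_act i j (x : sub_comp i) (a : A i j) : sub_comp j :=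
  Sub (gact (val x) a) (sub_act_subproof x a).

Program Definition gr_sub : gr_mod A :=
  {| gcomp := sub_comp; gact := sub_act |}.
Next Obligation. by move=> *; apply: val_inj; rewrite /= gactDl. Qed.
Next Obligation. by move=> *; apply: val_inj; rewrite /= gactDr. Qed.
Next Obligation. by move=> *; apply: val_inj; rewrite /= gactA. Qed.
Next Obligation. by move=> *; apply: val_inj; rewrite /= gact1. Qed.

Program Definition sub_incl : gr_hom gr_sub M :=
  {| gfun := fun i (x : gr_sub i) => val x |}.
Next Obligation. by []. Qed.
Next Obligation. by []. Qed.

Lemma sub_incl_inj : gr_inj sub_incl.
Proof. by move=> i; apply: val_inj. Qed.

Lemma sub_inclP i (x : gr_sub i) : U i (sub_incl i x).
Proof. by apply/asboolP; exact: (valP x). Qed.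

Lemma sub_inclE i (x : M i) : U i x -> exists y, sub_incl i y = x.
Proof.
move=> Ux; have xU : x \in sub_pred i by apply/asboolP.
by exists (Sub x xU : sub_comp i).
Qed.

Section Corestriction.
Variables (N : gr_mod A) (f : gr_hom N M) (fU : forall i x, U i (f i x)).

Fact sub_lift_subproof i x : f i x \in sub_pred i.
Proof. by apply/asboolP/fU. Qed.

Program Definition sub_lift : gr_hom N gr_sub :=
  {| gfun := fun i x => (Sub (f i x) (sub_lift_subproof x) : sub_comp i) |}.
Next Obligation. by move=> *; apply: val_inj; rewrite /= gfunD. Qed.
Next Obligation. by move=> *; apply: val_inj; rewrite /= gfunA. Qed.
End Corestriction.

Local Notation quo_comp i :=
  {ideal_quot (sub_pred i : zmodClosed (M i))}.

Lemma quo_eqP i (x y : M i) :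
  \pi_(quo_comp i) x = \pi_(quo_comp i) y <-> U i (x - y).
Proof.
split=> [/eqP|Uxy]; first by rewrite -Quotient.idealrBE => /asboolP.
by apply/eqP; rewrite -Quotient.idealrBE; apply/asboolP.
Qed.

Definition quo_act i j (x : quo_comp i) (a : A i j) : quo_comp j :=
  \pi_(quo_comp j) (gact (repr x) a).

Fact quo_actE i j (x : M i) (a : A i j) :
  quo_act (\pi_(quo_comp i) x) a = \pi_(quo_comp j) (gact x a).
Proof.
apply/quo_eqP; rewrite -gactBl; apply: smemA.
by apply/quo_eqP; rewrite reprK.
Qed.

Program Definition gr_quo : gr_mod A :=
  {| gcomp := fun i => quo_comp i; gact := quo_act |}.
Next Obligation.
move=> i j x y a; rewrite -[x]reprK -[y]reprK -raddfD !quo_actE.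
by rewrite gactDl raddfD.
Qed.
Next Obligation. by move=> i j x a b; rewrite /quo_act gactDr raddfD. Qed.
Next Obligation.
by move=> i j k x a b; rewrite -[x]reprK (quo_actE _ a) !quo_actE gactA.
Qed.
Next Obligation. by move=> i x; rewrite -[x]reprK !quo_actE gact1. Qed.

Program Definition quo_proj : gr_hom M gr_quo :=
  {| gfun := fun i x => \pi_(quo_comp i) x |}.
Next Obligation. by move=> i x y; exact: (raddfD (\pi_(quo_comp i))). Qed.
Next Obligation. by move=> i j x a; rewrite /= quo_actE. Qed.

Lemma quo_proj_surj : gr_surj quo_proj.
Proof. by move=> i y; exists (repr y); rewrite /= reprK. Qed.

Lemma quo_proj_eq0 i (x : M i) : quo_proj i x = 0 <-> U i x.
Proof.
by rewrite -[X in _ = X](raddf0 (quo_proj i)) /=; rewrite quo_eqP subr0.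
Qed.
End Submodule.

Arguments sub_incl_inj {I A M} U i [x1 x2].

(** * Products and coinduced modules *)

Section DependentProduct.
Variables (K : Type) (V : K -> zmodType).

Definition dfun : Type := forall k, V k.

HB.instance Definition _ := gen_eqMixin dfun.
HB.instance Definition _ := gen_choiceMixin dfun.

Definition dfun_zero : dfun := fun k => 0.
Definition dfun_opp (x : dfun) : dfun := fun k => - x k.
Definition dfun_add (x y : dfun) : dfun := fun k => x k + y k.

Fact dfun_addA : associative dfun_add.
Proof.
by move=> x y z; apply: functional_extensionality_dep => k; apply: addrA.
Qed.
Fact dfun_addC : commutative dfun_add.
Proof.
by move=> x y; apply: functional_extensionality_dep => k; apply: addrC.
Qed.
Fact dfun_add0 : left_id dfun_zero dfun_add.
Proof.
by move=> x; apply: functional_extensionality_dep => k; apply: add0r.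
Qed.
Fact dfun_addN : left_inverse dfun_zero dfun_opp dfun_add.
Proof.
by move=> x; apply: functional_extensionality_dep => k; apply: addNr.
Qed.

HB.instance Definition _ :=
  GRing.isZmodule.Build dfun dfun_addA dfun_addC dfun_add0 dfun_addN.
End DependentProduct.

Program Definition gr_prod (I : Type) (A : indexed_alg I) (K : Type)
    (N : K -> gr_mod A) : gr_mod A :=
  {| gcomp := fun i => dfun (fun k => N k i);
     gact := fun i j x a => fun k => gact (x k) a |}.
Next Obligation.
by move=> *; apply: functional_extensionality_dep => k; apply: gactDl.
Qed.
Next Obligation.
by move=> *; apply: functional_extensionality_dep => k; apply: gactDr.
Qed.
Next Obligation.
by move=> *; apply: functional_extensionality_dep => k; apply: gactA.
Qed.
Next Obligation.
by move=> *; apply: functional_extensionality_dep => k; apply: gact1.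
Qed.

Section ReducedProduct.
Context {I : Type} {A : indexed_alg I} {K : Type}.
Variables (N : K -> gr_mod A) (F : set_system K).
Context {FF : Filter F}.

(** The quotient of the product by this submodule is the module of germs of
    families along the filter [F]. *)
Program Definition null_families : submod (gr_prod N) :=
  {| smem := fun i x => F (fun k => x k = 0) |}.
Next Obligation. by move=> i; apply: filterE. Qed.
Next Obligation.
move=> i x y; apply: filterS2 => k xk yk.
by change (x k - y k = 0); rewrite xk yk subr0.
Qed.
Next Obligation.
by move=> i j x a; apply: filterS => k /= ->; rewrite gact0.
Qed.
End ReducedProduct.

Arguments null_families {I A K} N F {FF}.

(** The module whose component in degree [i] is the group of additive maps
    [A i j -> V]; it is right adjoint to taking the component of degree [j]. *)
Section Coinduced.
Context {I : Type} {A : indexed_alg I}.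
Variables (j : I) (V : zmodType).

Definition additive_pred i : {pred dfun (fun _ : A i j => V)} :=
  fun f => `[< zmod_morphism (f : A i j -> V) >].
Arguments additive_pred : clear implicits.

Fact additive_pred_zmod_closed i : zmod_closed (additive_pred i).
Proof.
split=> [|f g]; first by apply/asboolP => a b; rewrite subrr.
rewrite !unfold_in => /asboolP fB /asboolP gB; apply/asboolP => a b.
change (f (a - b) - g (a - b) = (f a - g a) - (f b - g b)).
by rewrite fB gB !opprD !opprK addrACA.
Qed.

HB.instance Definition _ i := GRing.isZmodClosed.Build
  (dfun (fun _ : A i j => V)) (additive_pred i) (@additive_pred_zmod_closed i).

Definition coind_comp i : Type :=
  {f : dfun (fun _ : A i j => V) | f \in additive_pred i}.

HB.instance Definition _ i := SubChoice.on (coind_comp i).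
HB.instance Definition _ i := [SubChoice_isSubZmodule of coind_comp i by <:].

Fact coindB i (f : coind_comp i) a b : val f (a - b) = val f a - val f b.
Proof. by case: f => f /= /asboolP. Qed.

Definition Coind i (f : A i j -> V) (fB : zmod_morphism f) : coind_comp i :=
  Sub (f : dfun (fun=> V)) (introT (asboolP _) fB).

Fact coind_act_subproof i k (f : coind_comp i) (a : A i k) :
  zmod_morphism (fun b : A k j => val f (imul a b)).
Proof. by move=> b b'; rewrite imulBr coindB. Qed.

Definition coind_act i k (f : coind_comp i) (a : A i k) : coind_comp k :=
  Coind (coind_act_subproof f a).

Lemma coind_ext i (f g : coind_comp i) : (forall a, val f a = val g a) -> f = g.
Proof.
by move=> fg; apply: val_inj; apply: functional_extensionality_dep.
Qed.

Lemma coindD i (f : coind_comp i) a b : val f (a + b) = val f a + val f b.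
Proof.
by apply/eqP; rewrite -subr_eq -coindB addrK.
Qed.

Program Definition coind : gr_mod A :=
  {| gcomp := coind_comp; gact := coind_act |}.
Next Obligation. by move=> *; apply: coind_ext. Qed.
Next Obligation.
by move=> i k f a b; apply: coind_ext => c; rewrite /= imulDl coindD.
Qed.
Next Obligation.
by move=> i k l f a b; apply: coind_ext => c; rewrite /= imulA.
Qed.
Next Obligation. by move=> i f; apply: coind_ext => a; rewrite /= imul1l. Qed.
End Coinduced.

Arguments coind {I} A j V.

(** * Reflective localization *)

Lemma nat_trans_ext (C D : category) (F G : functor C D) (s t : nat_trans F G) :
  (forall X, s X = t X) -> s = t.
Proof.
case: s t => [s sN] [t tN] /= st.
have {}st : s = t by apply: functional_extensionality_dep.
by subst t; congr NatTrans; apply: Prop_irrelevance.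
Qed.

Section Reflection.
Variables (C : category) (W : forall X Y : C, mor X Y -> Prop).

(** The objects that do not distinguish the source of a morphism in [W] from
    its target. *)
Definition local_object (N : C) : Prop :=
  forall (X Y : C) (f : mor X Y), W f ->
  forall g : mor X N, exists! h : mor Y N, mcomp h f = g.

Hypothesis enough_local :
  forall X : C, exists (N : C) (f : mor X N), local_object N /\ W f.

Let reflection (X : C) :
  {N : full_subcat local_object & {f : mor X (sval N) | W f}}.
Proof.
have /cid[N Hf] := enough_local X; have /cid[f [lN Wf]] := Hf.
by exists (exist _ N lN); exists f.
Qed.

Let R X : full_subcat local_object := tag (reflection X).
Let unit X : mor X (sval (R X)) := sval (tagged (reflection X)).
Let unitW X : W (unit X). Proof. exact: svalP (tagged (reflection X)). Qed.

Let ext (X Y N : C) (lN : local_object N) (f : mor X Y) (Wf : W f)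
  (g : mor X N) : mor Y N := sval (cid (lN X Y f Wf g)).

Let extE X Y N lN f Wf g : mcomp (@ext X Y N lN f Wf g) f = g.
Proof. by rewrite /ext; case: cid => h []. Qed.

Let ext_uniq X Y N (lN : local_object N) (f : mor X Y) (Wf : W f)
  (h h' : mor Y N) : mcomp h f = mcomp h' f -> h = h'.
Proof.
move=> hh'; have [k [_ kU]] := lN X Y f Wf (mcomp h f).
by rewrite -(kU h) // (kU h').
Qed.

Let Rmap X Y (f : mor X Y) : mor (sval (R X)) (sval (R Y)) :=
  ext (svalP (R Y)) (unitW X) (mcomp (unit Y) f).

Let RmapE X Y (f : mor X Y) : mcomp (Rmap f) (unit X) = mcomp (unit Y) f.
Proof. exact: extE. Qed.

Let Runiq X (N : full_subcat local_object) (h h' : mor (sval (R X)) (sval N)) :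
  mcomp h (unit X) = mcomp h' (unit X) -> h = h'.
Proof. exact: (ext_uniq (svalP N) (unitW X)). Qed.

Let Rmap_id X : Rmap (idm X) = idm (sval (R X)).
Proof. by apply: Runiq; rewrite RmapE comp_idl comp_idr. Qed.

Let Rmap_comp X Y Z (g : mor Y Z) (f : mor X Y) :
  Rmap (mcomp g f) = mcomp (Rmap g) (Rmap f).
Proof.
by apply: Runiq; rewrite RmapE -comp_assoc RmapE !comp_assoc RmapE.
Qed.

Let Q : functor C (full_subcat local_object) :=
  @Functor C (full_subcat local_object) R Rmap Rmap_id Rmap_comp.

Let unit_iso (N : full_subcat local_object) : 
  @is_iso (full_subcat local_object) N (R (sval N)) (unit (sval N)).
Proof.
exists (ext (svalP N) (unitW (sval N)) (idm _)); split; first exact: extE.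
by apply: Runiq; rewrite -comp_assoc extE comp_idl comp_idr.
Qed.

(** A morphism [f] in [W] induces a bijection on morphisms into the local
    object [R X], which turns the unit of [X] into an inverse of [Q f]. *)
Let Q_inverts : inverts W Q.
Proof.
move=> X Y f Wf; pose h := ext (svalP (R X)) Wf (unit X).
pose k : mor (sval (R Y)) (sval (R X)) := ext (svalP (R X)) (unitW Y) h.
have kE : mcomp k (unit Y) = h by exact: extE.
have hE : mcomp h f = unit X by exact: extE.
have kf : mcomp k (Rmap f) = idm (sval (R X)).
  by apply: Runiq; rewrite -comp_assoc RmapE comp_assoc kE hE comp_idl.
exists k; split=> //; apply: Runiq; rewrite /= -comp_assoc kE.
apply: (ext_uniq (svalP (R Y)) Wf).
by rewrite -comp_assoc hE RmapE comp_idl.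
Qed.

(** The unit is inverted by any functor inverting [W], so such a functor is
    recovered from its restriction to the local objects. *)
Let Q_factor (E : category) (F : functor C E) : inverts W F ->
  exists G : functor (full_subcat local_object) E,
    nat_isomorphic (functor_comp G Q) F.
Proof.
move=> invF; exists (functor_comp F (inclusion local_object)).
pose v X := sval (cid (invF _ _ _ (unitW X))).
have vP X : mcomp (v X) (fmap F (unit X)) = idm (F X) /\
    mcomp (fmap F (unit X)) (v X) = idm (F (sval (R X))).
  exact: svalP (cid (invF _ _ _ (unitW X))).
have vN X Y (f : mor X Y) :
    mcomp (v Y) (fmap F (Rmap f)) = mcomp (fmap F f) (v X).
  rewrite -[LHS]comp_idr -(vP X).2 comp_assoc; congr (mcomp _ (v X)).
  rewrite -comp_assoc -fmap_comp RmapE fmap_comp comp_assoc.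
  by rewrite (vP Y).1 comp_idl.
exists (@NatTrans _ _ (functor_comp (functor_comp F (inclusion _)) Q) F v vN).
by move=> X; exists (fmap F (unit X)); have [] := vP X.
Qed.

(** On a local object the unit is invertible, so a transformation [theta] is
    forced to be the conjugate of [eta] by the unit; that this conjugate
    restricts to [eta] along [Q] is naturality of [eta] at the unit itself. *)
Let Q_ff (E : category) (G G' : functor (full_subcat local_object) E)
    (eta : nat_trans (functor_comp G Q) (functor_comp G' Q)) :
  exists! theta : nat_trans G G', forall X : C, theta (Q X) = eta X.
Proof.
pose u (N : full_subcat local_object) :
  mor N (Q (sval N)) := unit (sval N).
pose v (N : full_subcat local_object) : mor (Q (sval N)) N :=
  sval (cid (unit_iso N)).
have vP (N : full_subcat local_object) : mcomp (v N) (u N) = idm N /\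
    mcomp (u N) (v N) = idm (Q (sval N)).
  exact: svalP (cid (unit_iso N)).
have uN (N N' : full_subcat local_object) (f : mor N N') :
    mcomp (u N') f = mcomp (fmap Q f) (u N).
  by rewrite /= RmapE.
pose th (N : full_subcat local_object) : mor (G N) (G' N) :=
  mcomp (fmap G' (v N)) (mcomp (eta (sval N)) (fmap G (u N))).
have thE (t : nat_trans G G') : (forall X : C, t (Q X) = eta X) ->
    forall N, t N = th N.
  move=> tQ N; rewrite /th -tQ nt_natural comp_assoc -fmap_comp (vP N).1.
  by rewrite fmap_id comp_idl.
have thN (N N' : full_subcat local_object) (f : mor N N') :
    mcomp (th N') (fmap G f) = mcomp (fmap G' f) (th N).
  rewrite /th -!comp_assoc -fmap_comp uN fmap_comp.
  rewrite [mcomp (eta (sval N')) _]comp_assoc.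
  have /= -> := nt_natural eta (f : mor (sval N) (sval N')).
  rewrite -!comp_assoc [LHS]comp_assoc [RHS]comp_assoc -!fmap_comp.
  congr (mcomp (fmap G' _) _).
  rewrite -[LHS]comp_idr -(vP N).2 comp_assoc; congr (mcomp _ (v N)).
  by rewrite -comp_assoc -uN comp_assoc (vP N').1 comp_idl.
pose theta := @NatTrans _ _ G G' th thN.
have thetaQ X : theta (Q X) = eta X.
  have uQ : u (Q X) = fmap Q (unit X).
    by apply: Runiq; rewrite /= RmapE.
  rewrite /= /th uQ; have /= -> := nt_natural eta (unit X).
  have /= vQ : mcomp (v (Q X)) (fmap Q (unit X)) = idm (Q X).
    by rewrite -uQ (vP (Q X)).1.
  rewrite comp_assoc -fmap_comp -[RHS]comp_idl -(fmap_id G').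
  by congr (mcomp (fmap G' _) _); exact: vQ.
exists theta; split=> // t tQ; apply: nat_trans_ext => N /=.
by rewrite (thE t).
Qed.

Let Q_adjoint : adjoint Q (inclusion local_object).
Proof.
exists (fun X N (g : mor (Q X) N) => mcomp (g : mor (sval (R X)) _) (unit X)).
split=> [X N|X X' N g f|X N N' h g] /=; last 2 first.
- by rewrite -!comp_assoc RmapE.
- by rewrite comp_assoc.
exists (fun g => ext (svalP N) (unitW X) g) => g; last exact: extE.
by apply: Runiq; rewrite extE.
Qed.

(** The quotient is realised by the local objects, so that the section functor
    is their inclusion. *)
Lemma reflective_localization :
  exists (D : category) (Q : functor C D),
    is_localization W Q /\ exists R : functor D C, adjoint Q R.
Proof.
exists (full_subcat local_object), Q; split; first exact: IsLocalization.
by exists (inclusion local_object).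
Qed.
End Reflection.

(** * Directed colimits of graded modules *)

Section FunctionalRelation.
Context {I : Type} {A : indexed_alg I}.
Variables (M N : gr_mod A) (R : forall i, M i -> N i -> Prop).
Arguments R : clear implicits.
Hypothesis Rtot : forall i x, exists z, R i x z.
Hypothesis Rfun : forall i x z z', R i x z -> R i x z' -> z = z'.
Hypothesis RD : forall i x x' z z',
  R i x z -> R i x' z' -> R i (x + x') (z + z').
Hypothesis RA : forall i j x z (a : A i j),
  R i x z -> R j (gact x a) (gact z a).

(** Morphisms out of colimits and localizations are given by their values on
    representatives; describing them by relations postpones every choice of
    representative to this lemma. *)
Lemma gr_hom_of_rel : exists h : gr_hom M N, forall i x, R i x (h i x).
Proof.
pose h i (x : M i) := sval (cid (Rtot x)).
have hP i (x : M i) : R i x (h i x) by exact: svalP (cid (Rtot x)).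
have hD i (x y : M i) : h i (x + y) = h i x + h i y.
  by apply: (Rfun (hP _ _)); apply: RD.
have hA i j (x : M i) (a : A i j) : h j (gact x a) = gact (h i x) a.
  by apply: (Rfun (hP _ _)); apply: RA.
by exists (GrHom hD hA).
Qed.
End FunctionalRelation.

Lemma fmap_poset (d : Order.disp_t) (J : porderType d) (C : category)
    (D : functor (poset_cat J) C) j k l (jk : (j <= k)%O) (kl : (k <= l)%O)
    (jl : (j <= l)%O) :
  mcomp (fmap D (kl : mor (k : poset_cat J) l))
    (fmap D (jk : mor (j : poset_cat J) k)) =
  fmap D (jl : mor (j : poset_cat J) l).
Proof. by rewrite -fmap_comp; congr fmap; apply: bool_irrelevance. Qed.

Section DirectedColimit.
Context {I : Type} {A : indexed_alg I} {d : Order.disp_t} {J : porderType d}.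
Hypothesis Jdir : directed J.

(** Requiring the bound only in the presence of an element of [J] makes this a
    filter also on the empty poset, whose colimits are zero. *)
Definition above : set_system J :=
  fun P => J -> exists j, forall k, (j <= k)%O -> P k.

Lemma above_filter : Filter above.
Proof.
split=> [j|P Q PJ QJ j|P Q PQ PJ j]; first by exists j.
  have [[k kP] [l lQ]] := (PJ j, QJ j).
  have [m [km lm]] := Jdir k l; exists m => n mn.
  by split; [apply: kP (le_trans km mn) | apply: lQ (le_trans lm mn)].
by have [k kP] := PJ j; exists k => l kl; apply/PQ/kP.
Qed.

Variables (D : functor (poset_cat J) (Gr A)) (X : Gr A).
Variable leg : forall j : poset_cat J, mor (D j) X.

Definition D_le j k (jk : (j <= k)%O) : gr_hom (D j) (D k) :=
  fmap D (jk : mor (j : poset_cat J) k).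

Lemma D_le_comp j k l (jk : (j <= k)%O) (kl : (k <= l)%O) (jl : (j <= l)%O)
  i (y : D j i) : D_le kl i (D_le jk i y) = D_le jl i y.
Proof. by rewrite /D_le -(fmap_poset D jk kl). Qed.

Definition legs_cover : Prop :=
  forall i (x : X i), x = 0 \/ exists j (y : D j i), leg j i y = x.

Definition legs_separate : Prop :=
  forall j i (y : D j i), leg j i y = 0 ->
    exists k (jk : (j <= k)%O), D_le jk i y = 0.

Lemma leg_le j k (jk : (j <= k)%O) i (y : D j i) :
  is_cocone leg -> leg k i (D_le jk i y) = leg j i y.
Proof. by move=> /(_ j k jk) <-. Qed.

Lemma common_stage i j k (y : D j i) (z : D k i) :
  is_cocone leg -> exists l (jl : (j <= l)%O) (kl : (k <= l)%O),
    leg l i (D_le jl i y) = leg j i y /\ leg l i (D_le kl i z) = leg k i z.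
Proof.
move=> cc; have [l [jl kl]] := Jdir j k; exists l, jl, kl.
by rewrite !leg_le.
Qed.

(** The legs corestrict to [U]; the induced map to [U], followed by the
    inclusion, is the identity by uniqueness. *)
Lemma colimit_ind (U : submod X) : is_colimit leg ->
  (forall j i (y : D j i), U i (leg j i y)) ->
  forall i x, U i x.
Proof.
move=> [cc univ] legU i x.
have ccU : @is_cocone _ _ D (gr_sub U : Gr A) (fun j => sub_lift (legU j)).
  move=> k l kl; apply: gr_hom_ext => i' y; apply: sub_incl_inj.
  exact: (f_equal (fun g : gr_hom (D k) X => g i' y) (cc k l kl)).
have [h [hleg _]] := univ _ _ ccU.
have [g [_ uniq]] := univ X leg cc.
have e : gr_comp (sub_incl U) h = gr_id X.
  transitivity g; last by apply: uniq => j; rewrite comp_idl.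
  apply/esym/uniq => j; apply: gr_hom_ext => i' y.
  exact: (f_equal (fun f : gr_hom (D j) (gr_sub U) => sub_incl U i' (f i' y))
    (hleg j)).
have -> : x = sub_incl U i (h i x).
  by rewrite -[LHS]/(gr_id X i x) -e.
exact: sub_inclP.
Qed.

Lemma colimit_cover : is_colimit leg -> legs_cover.
Proof.
move=> cX; have cc := cX.1.
(* The clause [x = 0] makes this a submodule when [J] is empty. *)
pose P i (x : X i) := x = 0 \/ exists j (y : D j i), leg j i y = x.
have P0 i : P i 0 by left.
have PB i x x' : P i x -> P i x' -> P i (x - x').
  case=> [->|[j [y <-]]] [->|[k [z <-]]]; first by left; rewrite subrr.
  - by right; exists k, (- z); rewrite raddfN sub0r.
  - by right; exists j, y; rewrite subr0.
  have [l [jl [kl [<- <-]]]] := common_stage y z cc.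
  by right; exists l, (D_le jl i y - D_le kl i z); rewrite raddfB.
have PA i j x (a : A i j) : P i x -> P j (gact x a).
  case=> [->|[k [y <-]]]; first by left; rewrite gact0.
  by right; exists k, (gact y a); rewrite gfunA.
apply: (colimit_ind (U := Submod P0 PB PA)) => // j i y.
by right; exists j, y.
Qed.

(** Testing the universal property against the reduced product of the whole
    diagram: an element of [D j] has a germ there, its images in the later
    [D k], and this germ vanishes only if some image does. *)
Lemma colimit_separate : is_colimit leg -> legs_separate.
Proof.
move=> [cc univ] j0 i y y0.
have FF := above_filter.
pose germ j i (z : D j i) : gr_prod (fun k : J => D k : gr_mod A) i :=
  fun k => if pselect (j <= k)%O is left jk then D_le jk i z else 0.
have germE j i' (z : D j i') k (jk : (j <= k)%O) : germ j i' z k = D_le jk i' z.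
  rewrite /germ; case: pselect => [jk'|//].
  by rewrite (bool_irrelevance jk jk').
have germD j i' x z : germ j i' (x + z) = germ j i' x + germ j i' z.
  apply: functional_extensionality_dep => k.
  change (germ j i' (x + z) k = germ j i' x k + germ j i' z k).
  by rewrite /germ; case: pselect => ?; rewrite ?raddfD ?addr0.
have germA j i' l x (a : A i' l) : germ j l (gact x a) = gact (germ j i' x) a.
  apply: functional_extensionality_dep => k.
  change (germ j l (gact x a) k = gact (germ j i' x k) a).
  by rewrite /germ; case: pselect => ?; rewrite ?gfunA ?gact0.
pose germ_hom j := GrHom (@germD j) (@germA j).
pose Z := null_families (fun k : J => D k : gr_mod A) above (FF := FF).
pose leg' j : gr_hom (D j) (gr_quo Z) := gr_comp (quo_proj Z) (germ_hom j).
have cc' : @is_cocone _ _ D (gr_quo Z : Gr A) leg'.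
  move=> k l kl; apply: gr_hom_ext => i' z.
  change (quo_proj Z i' (germ l i' (D_le kl i' z)) =
          quo_proj Z i' (germ k i' z)).
  apply/subr0_eq; rewrite -raddfB; apply/quo_proj_eq0 => ?.
  exists l => m lm; change (germ l i' (D_le kl i' z) m - germ k i' z m = 0).
  have km := le_trans kl lm.
  by rewrite (germE _ _ _ _ lm) (germE _ _ _ _ km) D_le_comp subrr.
have [h [hleg _]] := univ (gr_quo Z) leg' cc'.
have : leg' j0 i y = 0 by rewrite -hleg /= y0 raddf0.
move=> /quo_proj_eq0 /(_ j0)[k0 k0P].
have [k [k0k jk]] := Jdir k0 j0; exists k, jk.
by have := k0P k k0k; rewrite /= germE.
Qed.

(** A map out of [X] is read off representatives: two of them can be compared at
    a common stage, and those of 0 die at a later one. *)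
Lemma directed_colimit : is_cocone leg -> legs_cover -> legs_separate ->
  is_colimit leg.
Proof.
move=> cc cov sep; split=> // Y leg' cc'.
pose R i (x : X i) (z : Y i) :=
  (x = 0 /\ z = 0) \/
  exists j (y : D j i), leg j i y = x /\ leg' j i y = z.
have le' j k (jk : (j <= k)%O) i (y : D j i) :
    leg' k i (D_le jk i y) = leg' j i y.
  by rewrite -(cc' j k jk).
have RN i x z : R i x z -> R i (- x) (- z).
  case=> [[-> ->]|[j [y [<- <-]]]]; first by left; rewrite !oppr0.
  by right; exists j, (- y); rewrite !raddfN.
have RD i x x' z z' : R i x z -> R i x' z' -> R i (x + x') (z + z').
  case=> [[-> ->]|[j [y [<- <-]]]]; first by rewrite !add0r.
  case=> [[-> ->]|[k [y' [<- <-]]]].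
    by rewrite !addr0; right; exists j, y.
  have [l [jl kl]] := Jdir j k.
  right; exists l, (D_le jl i y + D_le kl i y').
  by rewrite !raddfD /= !leg_le // !le'.
have R0 i z : R i 0 z -> z = 0.
  case=> [[]//|[j [y [y0 <-]]]]; have [k [jk yk]] := sep j i y y0.
  by rewrite -(le' _ _ jk) yk raddf0.
have Rtot i x : exists z, R i x z.
  have [->|[j [y <-]]] := cov i x; first by exists 0; left.
  by exists (leg' j i y); right; exists j, y.
have Rfun i x z z' : R i x z -> R i x z' -> z = z'.
  move=> xz /RN xz'; apply/subr0_eq/(R0 i).
  by rewrite -[0](subrr x); apply: RD.
have RA i j x z (a : A i j) : R i x z -> R j (gact x a) (gact z a).
  case=> [[-> ->]|[k [y [<- <-]]]]; first by left; rewrite !gact0.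
  by right; exists k, (gact y a); rewrite !gfunA.
have [h hR] := gr_hom_of_rel Rtot Rfun RD RA.
exists h; split=> [j|h' h'leg].
  apply: gr_hom_ext => i y /=; apply: (Rfun _ _ _ _ (hR _ _)).
  by right; exists j, y.
apply: gr_hom_ext => i x; have [->|[j [y <-]]] := cov i x.
  by rewrite !raddf0.
transitivity (leg' j i y); last by rewrite -h'leg.
by apply: (Rfun _ _ _ _ (hR _ _)); right; exists j, y.
Qed.
End DirectedColimit.

(** * Torsion elements *)

Section Torsion.
Context {d : Order.disp_t} {I : porderType d} {A : indexed_alg I}.
Hypothesis Idir : directed I.

(** As for [above], the guard covers the empty poset. *)
Definition tails : set_system I :=
  fun P => I -> exists e, forall j, (e < j)%O -> P j.

#[local] Instance tails_filter : Filter tails.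
Proof.
split=> [i|P Q PI QI i|P Q PQ PI i]; first by exists i.
  have [[e eP] [f fQ]] := (PI i, QI i).
  have [g [eg fg]] := Idir e f; exists g => j gj.
  by split; [apply: eP (le_lt_trans eg gj) | apply: fQ (le_lt_trans fg gj)].
by have [e eP] := PI i; exists e => j ej; apply/PQ/eP.
Qed.

Definition killed (M : gr_mod A) i (x : M i) (j : I) : Prop :=
  forall a : A i j, gact x a = 0.

Program Definition tors (M : gr_mod A) : submod M :=
  {| smem := fun i x => tails (killed x) |}.
Next Obligation. by move=> M i; apply: filterE => j a; rewrite gact0. Qed.
Next Obligation.
move=> M i x y; apply: filterS2 => j x0 y0 a.
by rewrite gactBl x0 y0 subr0.
Qed.
Next Obligation.
by move=> M i k x a; apply: filterS => j x0 b; rewrite -gactA x0.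
Qed.

Program Definition killed_beyond (M : gr_mod A) (e : I) : submod M :=
  {| smem := fun i x => forall j, (e < j)%O -> killed x j |}.
Next Obligation. by move=> M e i j _ a; rewrite gact0. Qed.
Next Obligation.
by move=> M e i x y x0 y0 j ej a; rewrite gactBl x0 // y0 // subr0.
Qed.
Next Obligation. by move=> M e i k x a x0 j ej b; rewrite -gactA x0. Qed.

Lemma tors_hom (M N : gr_mod A) (f : gr_hom M N) i x :
  tors M i x -> tors N i (f i x).
Proof.
by apply: filterS => j x0 a; rewrite -gfunA x0 raddf0.
Qed.

Lemma tors_inj (M N : gr_mod A) (f : gr_hom M N) i x :
  gr_inj f -> tors N i (f i x) -> tors M i x.
Proof.
move=> fI; apply: filterS => j x0 a; apply: fI.
by rewrite gfunA x0 raddf0.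
Qed.

Lemma upper_bounded_tors (M : gr_mod A) : upper_bounded M ->
  forall i x, tors M i x.
Proof. by move=> [e e0] i x _; exists e => j ej a; apply: e0. Qed.

Lemma upper_bounded_killed_beyond (M : gr_mod A) e :
  upper_bounded (gr_sub (killed_beyond M e)).
Proof.
exists e => j ej x; apply: (sub_incl_inj (killed_beyond M e)).
by rewrite -[LHS]gact1 (sub_inclP x) // raddf0.
Qed.

Section Exhaustion.
Variable M : gr_mod A.

Fact killed_beyond_le e f (ef : (e <= f)%O) i
  (x : gr_sub (killed_beyond M e) i) :
  killed_beyond M f i (sub_incl (killed_beyond M e) i x).
Proof. by move=> j fj; apply: (sub_inclP x); apply: le_lt_trans ef fj. Qed.

Program Definition exhaustion : functor (poset_cat I) (Gr A) :=
  {| fob := fun e => gr_sub (killed_beyond M e) : Gr A;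
     fmap := fun e f ef => sub_lift (killed_beyond_le ef) |}.
Next Obligation.
move=> e; apply: gr_hom_ext => i x.
exact: (sub_incl_inj (killed_beyond M e)).
Qed.
Next Obligation.
move=> e f g fg ef; apply: gr_hom_ext => i x.
exact: (sub_incl_inj (killed_beyond M g)).
Qed.

Lemma exhaustion_colimit : (forall i x, tors M i x) ->
  @is_colimit _ _ exhaustion (M : Gr A) (fun e => sub_incl (killed_beyond M e)).
Proof.
move=> torsM; apply: directed_colimit => //.
- by move=> e f ef; apply: gr_hom_ext.
- move=> i x; right; have [e x0] := torsM i x i.
  by have [y <-] := sub_inclE (U := killed_beyond M e) x0; exists e, y.
move=> e i x x0; exists e, (lexx e).
have -> : x = 0 by apply: (sub_incl_inj (killed_beyond M e)); rewrite x0 raddf0.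
by rewrite raddf0.
Qed.
End Exhaustion.

(** The torsion elements of a colimit form a submodule containing the images of
    the upper-bounded stages, so they are everything; conversely a module of
    torsion elements is exhausted by its submodules [killed_beyond]. *)
Lemma torsionP (M : gr_mod A) : torsion M <-> forall i x, tors M i x.
Proof.
split=> [[d' [J [D [leg [Jdir Mcolim Dub]]]]]|torsM].
  apply: (colimit_ind (U := tors M) Mcolim) => j i y.
  by apply: tors_hom; apply: upper_bounded_tors.
exists d, I, (exhaustion M), (fun e => sub_incl (killed_beyond M e)).
split=> //.
- exact: exhaustion_colimit.
- by move=> e; apply: upper_bounded_killed_beyond.
Qed.

(** * Finitely generated tails *)

Section FinitelyGeneratedTails.
Variables (Apos : positively_indexed A) (Atfg : tails_finitely_generated Apos).

(** The images of the basis vectors [delta k] of the free module generate; a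
    generator in a degree not above [e] lies in a zero component. *)
Lemma tail_generators i e : exists (n : nat) (s : 'I_n -> I)
    (g : forall k, A i (s k)), (forall k, (e < s k)%O \/ g k = 0) /\
  forall j, (e < j)%O -> forall a : A i j, exists b : forall k, A (s k) j,
    a = \sum_k imul (g k) (b k).
Proof.
have [n [s [f fsurj]]] := Atfg i e.
pose delta k : gr_dsum (fun k => gr_proj A (s k)) (s k) :=
  finfun (dfwith (fun l => 0 : A (s l) (s k)) (iunit (s k))).
pose g k : A i (s k) := val (f (s k) (delta k)).
exists n, s, g; split=> [k|j ej a].
  have := valP (f (s k) (delta k)); rewrite unfold_in.
  by case/orP => [|/eqP]; [left | right].
have at_j : a \in tail_pred (gr_proj A i) e j by rewrite unfold_in ej.
have [x fx] := fsurj j (Sub a at_j).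
have xE : x = \sum_k gact (delta k) (x k).
  apply/ffunP => l.
  rewrite (big_morph (fun y : gr_dsum (fun k => gr_proj A (s k)) j => y l)
    (id1 := 0) (op1 := +%R)) => [|y z|]; rewrite ?ffunE //.
  rewrite (bigD1 l) //= big1 => [|k kl].
    by rewrite addr0 !ffunE dfwith_in /= imul1l.
  by rewrite !ffunE dfwith_out // imul0.
exists (fun k => x k); have : val (f j x) = a by rewrite fx.
rewrite {1}xE raddf_sum => <-.
rewrite (big_morph (fun y : tail Apos (gr_proj A i) e j => val y)
  (id1 := 0) (op1 := +%R)) //.
by apply: eq_bigr => k _; exact: (f_equal val (gfunA f (delta k) (x k))).
Qed.

(** If every element of the tail satisfies [R k] for [F]-many [k], then finite
    generation makes the choice of [k] uniform. *)
Lemma tail_uniform (K : Type) (F : set_system K) {FF : Filter F} i e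
    (R : K -> forall j, A i j -> Prop) :
  (forall k j, R k j 0) ->
  (forall k j a b, R k j a -> R k j b -> R k j (a + b)) ->
  (forall k j l a (b : A j l), R k j a -> R k l (imul a b)) ->
  (forall j, (e < j)%O -> forall a, F (fun k => R k j a)) ->
  F (fun k => forall j, (e < j)%O -> forall a, R k j a).
Proof.
move=> R0 RD RM FR; have [n [s [g [gP gen]]]] := tail_generators i e.
have: F (fun k => forall m : 'I_n, R k (s m) (g m)).
  apply: filter_forall => m.
  by case: (gP m) => [em|->]; [apply: FR | apply: filterE].
apply: filterS => k Rg j ej a; have [b ->] := gen j ej a.
by elim/big_ind: _ => // [x y|m _]; [apply: RD | apply: RM].
Qed.

(** The form in which uniformity is used within [I]: a property of the elements
    [a : A i l] holds for all late [l] as soon as, for each late [a], it holds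
    for all late multiples of [a].  The conclusion is recovered from
    [tail_uniform] by taking the multiplier to be a local unit. *)
Lemma tails_uniform i (R : forall j, A i j -> Prop) :
  (forall j, R j 0) ->
  (forall j a b, R j a -> R j b -> R j (a + b)) ->
  tails (fun j => forall a : A i j,
    tails (fun l => forall b : A j l, R l (imul a b))) ->
  tails (fun l => forall a, R l a).
Proof.
move=> R0 RD tR i0; have [e eR] := tR i0.
pose S l j (a : A i j) := forall b : A j l, R l (imul a b).
have St : tails (fun l => forall j, (e < j)%O -> forall a, S l j a).
  apply: tail_uniform => [l j b|l j a b Sa Sb c|l j k a b Sa c|].
  - by rewrite imul0.
  - by rewrite imulDl; apply: RD; [apply: Sa | apply: Sb].
  - by rewrite -imulA; apply: Sa.
  - by move=> j ej a; apply: eR.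
have te : tails (fun l => (e < l)%O) by move=> _; exists e.
suff: tails (fun l => forall a, R l a) by apply.
by move: te St; apply: filterS2 => l el Sl a; rewrite -[a]imul1r; apply: Sl.
Qed.

(** Uniformity for the property [x a = 0]; this is the extension-closure of
    torsion, read on elements. *)
Lemma tors_of_multiples (M : gr_mod A) i (x : M i) :
  tails (fun j => forall a : A i j, tors M j (gact x a)) -> tors M i x.
Proof.
move=> tx; apply: (@tails_uniform i (fun j a => gact x a = 0)).
- by move=> j; rewrite gact0r.
- by move=> j a b xa xb; rewrite gactDr xa xb addr0.
apply: filterS tx => j tx a; apply: filterS (tx a) => l x0 b.
by rewrite gactA x0.
Qed.

(** In an extension, the multiples of an element by a tail that kills its image
    in the quotient come from the submodule, where they are torsion. *)
Lemma torsion_serre : is_serre (@torsion d I A).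
Proof.
split.
  exists (gr_prod (of_void (gr_mod A))); apply/torsionP => i x _; exists i.
  by move=> j _ a; apply: functional_extensionality_dep; case.
move=> M' M M'' f g fI fg gS.
split=> [/torsionP tM|[/torsionP tM' /torsionP tM'']].
  split; apply/torsionP => i x; first exact: tors_inj fI (tM _ _).
  by have [y <-] := gS i x; apply: tors_hom.
apply/torsionP => i x; apply: tors_of_multiples.
apply: filterS (tM'' i (g i x)) => j gx0 a.
have [|z <-] := (fg j (gact x a)).1; first by rewrite gfunA gx0.
exact: tors_hom.
Qed.

(** * The torsion functor *)

Lemma torsion_tors (M : gr_mod A) : torsion (gr_sub (tors M)).
Proof.
apply/torsionP => i x; apply: (tors_inj (sub_incl_inj (tors M))).
exact: sub_inclP.
Qed.

Fact tors_map_subproof (M N : gr_mod A) (f : gr_hom M N) i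
  (x : gr_sub (tors M) i) : tors N i (gr_comp f (sub_incl (tors M)) i x).
Proof. exact: (tors_hom f (sub_inclP x)). Qed.

Definition tors_map (M N : gr_mod A) (f : gr_hom M N) :
    gr_hom (gr_sub (tors M)) (gr_sub (tors N)) :=
  sub_lift (tors_map_subproof f).

Program Definition torsion_functor :
    functor (Gr A) (full_subcat (@torsion d I A)) :=
  {| fob := fun M => exist _ (gr_sub (tors M) : Gr A) (torsion_tors M);
     fmap := fun M N f => tors_map f |}.
Next Obligation.
by move=> M; apply: gr_hom_ext => i x; apply: (sub_incl_inj (tors M)).
Qed.
Next Obligation.
by move=> M N P g f; apply: gr_hom_ext => i x;
  apply: (sub_incl_inj (tors P)).
Qed.

Lemma torsion_functor_adjoint :
  adjoint (inclusion (@torsion d I A)) torsion_functor.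
Proof.
have torsT (X : full_subcat (@torsion d I A)) (Y : Gr A)
    (f : gr_hom (sval X) Y) i x : tors Y i (f i x).
  exact: (tors_hom f ((torsionP (sval X)).1 (svalP X) i x)).
exists (fun X Y f => sub_lift (torsT X Y f)).
split=> [X Y|X X' Y g f|X Y Y' h g].
- exists (gr_comp (sub_incl (tors Y))) => g; apply: gr_hom_ext => i x //.
  exact: (sub_incl_inj (tors Y)).
- by apply: gr_hom_ext => i x; apply: (sub_incl_inj (tors Y)).
- by apply: gr_hom_ext => i x; apply: (sub_incl_inj (tors Y')).
Qed.

Lemma full_subcat_colimit (K C : category) (S : C -> Prop)
    (D : functor K (full_subcat S)) (X : full_subcat S)
    (leg : forall k, mor (D k) X) :
  @is_colimit K C (functor_comp (inclusion S) D) (sval X) leg ->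
  is_colimit leg.
Proof.
move=> [cc univ]; split=> // Y leg' cc'.
exact: (univ (sval Y) leg' cc').
Qed.

(** If [y] in a stage has torsion image in the colimit, then each multiple of
    [y] by an element of a fixed tail dies at a later stage; finite generation
    of the tail provides a single stage at which [y] itself is torsion. *)
Lemma torsion_finite_type : of_finite_type (@torsion d I A).
Proof.
exists torsion_functor; split; first exact: torsion_functor_adjoint.
move=> d' J Jdir D X leg lim; have FF := above_filter Jdir.
have cc := lim.1; have cov := colimit_cover Jdir lim.
have sep := colimit_separate Jdir lim.
apply: full_subcat_colimit; apply: directed_colimit => //.
- move=> j k jk; apply: gr_hom_ext => i y.
  apply: (sub_incl_inj (tors X)).
  exact: (leg_le jk (sub_incl (tors (D j)) i y) cc).
- move=> i x; have tx := sub_inclP x.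
  case: (cov i (sub_incl (tors X) i x)) => [x0|[j [y yx]]].
    by left; apply: (sub_incl_inj (tors X)); rewrite x0 raddf0.
  right; have [e eP] := tx i.
  pose R k l (a : A i l) := forall jk : (j <= k)%O, gact (D_le D jk i y) a = 0.
  have late : above (fun k => forall l, (e < l)%O -> forall a, R k l a).
    apply: tail_uniform => [k l jk|k l a b Ra Rb jk|k l m a b Ra jk|l el a].
    + by rewrite gact0r.
    + by rewrite gactDr Ra Rb addr0.
    + by rewrite gactA Ra gact0.
    have [|k [jk ka]] := sep j l (gact y a); first by rewrite gfunA yx eP.
    move=> _; exists k => m km jm; rewrite -gfunA.
    by rewrite -(D_le_comp (D := D) jk km) ka raddf0.
  have [k0 k0R] := late j; have [k [k0k jk]] := Jdir k0 j.
  have tk : tors (D k) i (D_le D jk i y).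
    by move=> _; exists e => l el a; apply: k0R.
  have [z zE] := sub_inclE tk; exists k, z.
  by apply: (sub_incl_inj (tors X)); rewrite -yx -(leg_le jk y cc) -zE.
move=> j i y y0.
have [|k [jk yk]] := sep j i (sub_incl (tors (D j)) i y).
  exact: (f_equal (sub_incl (tors X) i) y0).
by exists k, jk; apply: (sub_incl_inj (tors (D k))).
Qed.

(** * Morphisms inverted by the quotient *)

Definition torsion_free (M : gr_mod A) : Prop :=
  forall i (x : M i), tors M i x -> x = 0.

Definition tors_kernel (M N : gr_mod A) (f : gr_hom M N) : Prop :=
  forall i (x : M i), f i x = 0 -> tors M i x.

Definition tors_cokernel (M N : gr_mod A) (f : gr_hom M N) : Prop :=
  forall i (y : N i),
    tails (fun j => forall a : A i j, exists x, f j x = gact y a).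

Program Definition kernel (M N : gr_mod A) (f : gr_hom M N) : submod M :=
  {| smem := fun i x => f i x = 0 |}.
Next Obligation. by move=> M N f i; rewrite /= raddf0. Qed.
Next Obligation. by move=> M N f i x y x0 y0; rewrite /= gfunB x0 y0 subr0. Qed.
Next Obligation. by move=> M N f i j x a x0; rewrite /= gfunA x0 gact0. Qed.

Program Definition image (M N : gr_mod A) (f : gr_hom M N) : submod N :=
  {| smem := fun i y => exists x, f i x = y |}.
Next Obligation. by move=> M N f i; exists 0; rewrite raddf0. Qed.
Next Obligation.
by move=> M N f i _ _ [x <-] [y <-]; exists (x - y); rewrite raddfB.
Qed.
Next Obligation.
by move=> M N f i j _ a [x <-]; exists (gact x a); rewrite gfunA.
Qed.

Lemma iso_modP (M N : gr_mod A) (f : gr_hom M N) :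
  iso_mod (@torsion d I A) (f : @mor (Gr A) M N) <->
  tors_kernel f /\ tors_cokernel f.
Proof.
split=> [[K [L [k [c [/torsionP tK /torsionP tL [kI kf] [fc cS]]]]]]|[kT cT]].
  split=> i x.
    by move=> /kf[z <-]; apply: tors_hom.
  apply: filterS (tL i (c i x)) => j cx0 a.
  by apply/fc; rewrite gfunA cx0.
exists (gr_sub (kernel f)), (gr_quo (image f)), (sub_incl _), (quo_proj _).
split.
- apply/torsionP => i x; apply: (tors_inj (sub_incl_inj (kernel f))).
  by apply: kT; exact: (sub_inclP x).
- apply/torsionP => i y; have [x <-] := quo_proj_surj y.
  apply: filterS (cT i x) => j xP a; rewrite -gfunA.
  exact/quo_proj_eq0/xP.
- split=> [|i x]; first exact: sub_incl_inj.
  split=> [x0|[y <-]]; last exact: (sub_inclP y).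
  exact: (sub_inclE (U := kernel f) x0).
- split=> [i y|]; last exact: quo_proj_surj.
  exact: quo_proj_eq0.
Qed.

(** * Closed modules *)

(** A family of maps [A i j -> N j] is a germ at infinity of a morphism from
    [gr_proj A i] to [N] when it is additive and linear for late [j]. *)
Definition germ_at (N : gr_mod A) i (phi : forall j, A i j -> N j) (j : I) :=
  (forall a b, phi j (a - b) = phi j a - phi j b) /\
  (forall k a (b : A j k), phi k (imul a b) = gact (phi j a) b).

(** The two clauses are the uniqueness and the existence of an element whose
    late multiples realise a given germ. *)
Definition closed_mod (N : gr_mod A) : Prop :=
  torsion_free N /\
  forall i (phi : forall j, A i j -> N j), tails (germ_at phi) ->
    exists x : N i, tails (fun j => forall a, gact x a = phi j a).

Lemma torsion_freeP (N : gr_mod A) i (x y : N i) : torsion_free N ->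
  tails (fun j => forall a : A i j, gact x a = gact y a) -> x = y.
Proof.
move=> tf xy; apply/subr0_eq/tf; apply: filterS xy => j xy a.
by rewrite gactBl xy subrr.
Qed.

(** To extend [g : X -> N] along [f : X -> Y], send [y] to the element [z] whose
    late multiples [z a] are the [g x] with [f x = y a]; such [x] exist because
    the cokernel is torsion, and [g x] depends only on [f x] because [g] kills
    the torsion kernel. *)
Lemma closed_local (N : gr_mod A) : closed_mod N ->
  local_object (iso_mod (@torsion d I A)) (N : Gr A).
Proof.
move=> [tf clN] X Y f /iso_modP[kT cT] g.
have gE i x x' : f i x = f i x' -> g i x = g i x'.
  move=> xx'; apply/subr0_eq; rewrite -raddfB; apply/tf/tors_hom/kT.
  by rewrite gfunB xx' subrr.
pose R i (y : Y i) (z : N i) := tails (fun j => forall a : A i j,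
  exists x, f j x = gact y a /\ g j x = gact z a).
have Rfun i y z z' : R i y z -> R i y z' -> z = z'.
  move=> yz yz'; apply: (torsion_freeP tf); move: yz yz'.
  apply: filterS2 => j yz yz' a.
  have [[x [xy <-]] [x' [xy' <-]]] := (yz a, yz' a).
  by apply: gE; rewrite xy xy'.
have RD i y y' z z' : R i y z -> R i y' z' -> R i (y + y') (z + z').
  apply: filterS2 => j yz yz' a.
  have [[x [xy xz]] [x' [xy' xz']]] := (yz a, yz' a).
  by exists (x + x'); rewrite !gfunD xy xz xy' xz' !gactDl.
have RA i j y z (a : A i j) : R i y z -> R j (gact y a) (gact z a).
  apply: filterS => k yz b; have [x xP] := yz (imul a b).
  by exists x; rewrite -!gactA.
have Rf i x : R i (f i x) (g i x).
  by apply: filterE => j a; exists (gact x a); rewrite !gfunA.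
have Rtot i y : exists z, R i y z.
  (* Junk value 0 where [y a] is not in the image of [f]. *)
  pose phi j (a : A i j) : N j :=
    if pselect (exists x, f j x = gact y a) is left ex
    then g j (sval (cid ex)) else 0.
  have phiE j (a : A i j) x : f j x = gact y a -> phi j a = g j x.
    rewrite /phi; case: pselect => [ex|nex xy]; last by case: nex; exists x.
    by case: cid => x' /= <- xx'; apply: gE.
  have [|z zE] := clN i phi.
    apply: filterS (cT i y) => j ex; split=> [a b|k a b].
      have [[x xa] [x' xb]] := (ex a, ex b).
      rewrite (phiE _ _ _ xa) (phiE _ _ _ xb) -raddfB; apply: phiE.
      by rewrite gfunB xa xb; apply/eqP; rewrite subr_eq -gactDr subrK.
    have [x xa] := ex a.
    rewrite (phiE _ _ _ xa) -gfunA; apply: phiE.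
    by rewrite gfunA xa gactA.
  exists z; move: (cT i y) zE; apply: filterS2 => j ex zE a.
  by have [x xa] := ex a; exists x; rewrite zE (phiE _ _ _ xa).
have [h hR] := gr_hom_of_rel Rtot Rfun RD RA.
exists h; split=> [|h' h'f].
  by apply: gr_hom_ext => i x; apply: (Rfun _ _ _ _ (hR _ _)); apply: Rf.
apply: gr_hom_ext => i y; apply: (Rfun _ _ _ _ (hR _ _)).
apply: filterS (cT i y) => j ex a; have [x xa] := ex a; exists x; split=> //.
by rewrite -gfunA -xa -h'f.
Qed.

(** * The closed hull *)

Lemma torsion_free_quo (M : gr_mod A) : torsion_free (gr_quo (tors M)).
Proof.
move=> i y; have [x <-] := quo_proj_surj y => tx.
apply/quo_proj_eq0/tors_of_multiples; apply: filterS tx => j x0 a.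
by apply/quo_proj_eq0; rewrite gfunA x0.
Qed.

Section Hull.
Variables (M : gr_mod A) (Mtf : torsion_free M).

Let P := gr_prod (fun j => coind A j (M j)).
Let Z : submod P := null_families (fun j => coind A j (M j)) tails.

Fact orbit_subproof i (x : M i) j : zmod_morphism (fun a : A i j => gact x a).
Proof.
by move=> a b; apply/eqP; rewrite eq_sym subr_eq -gactDr subrK.
Qed.

(** The orbit map [a |-> x a] of an element; its germ vanishes iff [x] is
    torsion. *)
Program Definition orbit : gr_hom M P :=
  {| gfun := fun i x => fun j => Coind (@orbit_subproof i x j) |}.
Next Obligation.
move=> i x y; apply: functional_extensionality_dep => j.
by apply: coind_ext => a; exact: gactDl.
Qed.
Next Obligation.
move=> i k x a; apply: functional_extensionality_dep => j.
by apply: coind_ext => b; rewrite /= gactA.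
Qed.

Let germ : gr_hom M (gr_quo Z) := gr_comp (quo_proj Z) orbit.

Lemma germ_inj : gr_inj germ.
Proof.
move=> i x y xy; apply/subr0_eq/Mtf.
have /quo_proj_eq0 x0 : germ i (x - y) = 0.
  by rewrite gfunB xy subrr.
apply: filterS x0 => j x0 a.
exact: (f_equal (fun f : coind A j (M j) i => val f a) x0).
Qed.

(** If each late multiple of a family [f] is eventually zero, then by uniformity
    so is [f]. *)
Lemma torsion_free_germs : torsion_free (gr_quo Z).
Proof.
move=> i y; have [f <-] := quo_proj_surj y => tf; apply/quo_proj_eq0.
have : tails (fun l => forall a : A i l, val (f l) a = 0).
  apply: (tails_uniform (R := fun l (a : A i l) => val (f l) a = 0)).
  - by move=> l; rewrite -(subrr 0) coindB subrr.
  - by move=> l a b fa fb; rewrite coindD fa fb addr0.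
  apply: filterS tf => j fj a.
  have /quo_proj_eq0 : quo_proj Z j (gact f a) = 0 by rewrite gfunA fj.
  apply: filterS => l f0 b.
  exact: (f_equal (fun g : coind A l (M l) j => val g b) f0).
by apply: filterS => l f0; apply: coind_ext.
Qed.

Program Definition saturation : submod (gr_quo Z) :=
  {| smem := fun i y =>
       tails (fun j => forall a : A i j, exists x, germ j x = gact y a) |}.
Next Obligation.
by move=> i; apply: filterE => j a; exists 0; rewrite gact0 raddf0.
Qed.
Next Obligation.
move=> i y y'; apply: filterS2 => j yM yM' a.
have [[x xy] [x' xy']] := (yM a, yM' a).
by exists (x - x'); rewrite raddfB gactBl -xy -xy'.
Qed.
Next Obligation.
by move=> i k y a; apply: filterS => j yM b; rewrite -gactA; apply: yM.
Qed.

Fact germ_saturation i x : saturation i (germ i x).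
Proof. by apply: filterE => j a; exists (gact x a); rewrite gfunA. Qed.

Definition hull : gr_mod A := gr_sub saturation.
Definition hull_unit : gr_hom M hull := sub_lift germ_saturation.
Let incl : gr_hom hull (gr_quo Z) := sub_incl saturation.
Let inclI : gr_inj incl. Proof. exact: sub_incl_inj. Qed.

Lemma hull_unit_inj : gr_inj hull_unit.
Proof. by move=> i x y xy; apply: germ_inj; exact: (f_equal (incl i) xy). Qed.

Lemma hull_unit_cokernel : tors_cokernel hull_unit.
Proof.
move=> i y; apply: filterS (sub_inclP y) => j yM a.
by have [x xy] := yM a; exists x; apply: inclI; rewrite gfunA -xy.
Qed.

(** A germ of a morphism into the hull takes values in [M] at late degrees:
    each single late value has all its late multiples in [M], and uniformity
    applies.  Read in [M], the germ is itself an element of the hull. *)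
Lemma hull_closed : closed_mod hull.
Proof.
split=> [i y ty|i phi phig].
  by apply: inclI; rewrite raddf0; apply/torsion_free_germs/tors_hom.
pose G j := germ_at phi j.
have phi0 j : G j -> phi j 0 = 0.
  by move=> [phiB _]; rewrite -[X in phi j X](subrr 0) phiB subrr.
have late : tails (fun j => forall a, G j -> exists x, hull_unit j x = phi j a).
  apply: (tails_uniform
    (R := fun j a => G j -> exists x, hull_unit j x = phi j a)).
  - by move=> j /phi0 ->; exists 0; rewrite raddf0.
  - move=> j a b aM bM Gj; have [[x xa] [y yb]] := (aM Gj, bM Gj).
    exists (x + y); rewrite gfunD xa yb; apply/esym/eqP.
    by rewrite -subr_eq -Gj.1 addrK.
  apply: filterS phig => j [_ phiA] a.
  apply: filterS (hull_unit_cokernel (phi j a)) => l aM b _.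
  by rewrite phiA; apply: aM.
(* The lift of [phi] to [M], with junk value 0 where there is none. *)
pose psi j (a : A i j) : M j :=
  if pselect (exists x, hull_unit j x = phi j a) is left ex
  then sval (cid ex) else 0.
have psiE j a x : hull_unit j x = phi j a -> psi j a = x.
  rewrite /psi; case: pselect => [ex|nex xa]; last by case: nex; exists x.
  by case: cid => x' /= <- /hull_unit_inj.
have unitK : tails (fun j => G j /\ forall a, hull_unit j (psi j a) = phi j a).
  apply: filterS2 phig late => j Gj aM; split=> // a.
  by have [x xa] := aM a Gj; rewrite (psiE _ _ _ xa).
have psiB j : G j -> (forall a, hull_unit j (psi j a) = phi j a) ->
    zmod_morphism (psi j).
  by move=> Gj aM a b; apply: psiE; rewrite gfunB !aM Gj.1.
have psiA j k a (b : A j k) :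
    G j -> (forall a, hull_unit j (psi j a) = phi j a) ->
    psi k (imul a b) = gact (psi j a) b.
  by move=> Gj aM; apply: psiE; rewrite gfunA aM Gj.2.
pose f : P i := fun j =>
  if pselect (zmod_morphism (psi j)) is left psiB then Coind psiB else 0.
have fE : tails (fun j => forall a, val (f j) a = psi j a).
  apply: filterS unitK => j [Gj aM] a; rewrite /f.
  by case: pselect => // nB; case: nB; apply: psiB.
have fgerm : tails (fun j => forall a,
    gact (quo_proj Z i f) a = germ j (psi j a)).
  apply: filterS unitK => j [Gj aM] a.
  apply/subr0_eq; rewrite -gfunA -[germ j _]/(quo_proj Z j (orbit j (psi j a))).
  rewrite -gfunB; apply/quo_proj_eq0; apply: filterS fE => l fl.
  apply: coind_ext => b.
  change (val (f l) (imul a b) - gact (psi j a) b = 0).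
  by rewrite fl psiA // subrr.
have fsat : saturation i (quo_proj Z i f).
  by apply: filterS fgerm => j fj a; exists (psi j a).
have [x xE] := sub_inclE fsat; exists x.
apply: filterS2 fgerm unitK => j fj [Gj aM] a.
by apply: inclI; rewrite gfunA [incl i x]xE fj -aM.
Qed.
End Hull.

(** Only torsion is lost in [M -> M / tors M], and the hull of the torsion-free
    quotient adds only elements that are torsion modulo it. *)
Lemma closed_hull (M : Gr A) : exists (N : Gr A) (f : mor M N),
  local_object (iso_mod (@torsion d I A)) N /\ iso_mod (@torsion d I A) f.
Proof.
have Mtf := @torsion_free_quo M.
exists (hull (gr_quo (tors M))), (gr_comp (hull_unit _) (quo_proj (tors M))).
split; first exact/closed_local/hull_closed.
apply/iso_modP; split=> [i x x0|i y].
  have /quo_proj_eq0 // : quo_proj (tors M) i x = 0.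
  by apply: (hull_unit_inj Mtf); rewrite raddf0.
apply: filterS (hull_unit_cokernel y) => j yM a.
have [z <-] := yM a; have [x <-] := quo_proj_surj z.
by exists x.
Qed.

Lemma torsion_localising : localising (@torsion d I A).
Proof.
split; first exact: torsion_serre.
exact: (reflective_localization closed_hull).
Qed.
End FinitelyGeneratedTails.
End Torsion.

Theorem theorem3p18 (d : Order.disp_t) (I : porderType d)
    (Ilf : locally_finite I) (Idir : directed I)
    (A : indexed_alg I) (Aconn : connected A)
    (Apos : positively_indexed A) (Atfg : tails_finitely_generated Apos) :
  localising (@torsion d I A) /\ of_finite_type (@torsion d I A).
Proof.
by split; [exact: torsion_localising Atfg | exact: torsion_finite_type Atfg].
Qed.
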